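(* Let $A$ be a positive information algebra, let $L$ be a nonempty well-ordered set disjoint from $A$, and let $S=A\uplus_{\mathrm{ord}}L$ be the overflow semiring. If $\mathfrak{m}$ is a maximal ideal of $A$, then $\mathfrak{m}\cup L$ is a maximal ideal of $S$. Conversely, if $\mathfrak{M}$ is a maximal ideal of $S$, then $\mathfrak{M}\cap A$ is a maximal ideal of $A$. In particular, $A$ is local if and only if $S$ is local.
   Context: All semirings are commutative: $(S,+,0)$ and $(S,\cdot,1)$ are commutative monoids, $1\neq 0$, multiplication distributes over addition, and $0$ is absorbing. A semiring is zerosumfree if $a+b=0$ implies $a=b=0$, and entire if $ab=0$ implies $a=0$ or $b=0$; an information algebra is a zerosumfree entire semiring. A positive information algebra is an information algebra with a partial order $\leq$ compatible with $+$ and $\cdot$ (i.e. $x\leq y$ implies $x+z\leq y+z$ and $xz\leq yz$) and having $0$ as least element. An ideal of a semiring $S$ is a nonempty subset $I$ with $a+b\in I$ and $sa\in I$ for all $a,b\in I$, $s\in S$. A maximal ideal is a proper ideal maximal under inclusion among proper ideals. A semiring is local if it has a unique maximal ideal. Overflow semiring $S=A\uplus_{\mathrm{ord}}L$: for a positive information algebra $A$ and a join-semilattice $L$ disjoint from $A$, $S=A\cup L$ with the order extending those of $A$ and $L$ by $a\leq\ell$ for all $a\in A,\ell\in L$ (and never $\ell\leq a$), and operations: $x+y=x+_Ay$ if $x,y\in A$, $x+y=\sup\{x,y\}$ otherwise; $xy=x\cdot_Ay$ if $x,y\in A\setminus\{0\}$, $xy=0$ if $x=0$ or $y=0$, and $xy=\sup\{x,y\}$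 otherwise. With these, $S$ is a positive information algebra. *)

(* Defs.v *)
From HB Require Import structures.
From mathcomp Require Import all_boot all_order all_algebra.
From mathcomp Require Import boolp classical_sets.
From mathcomp Require wochoice.

Set Implicit Arguments.
Unset Strict Implicit.
Unset Printing Implicit Defensive.

Import Order.TTheory GRing.Theory.
Local Open Scope classical_set_scope.
Local Open Scope ring_scope.

HB.mixin Record isInfoAlgebra A of GRing.ComNzSemiRing A := {
  zerosumfree : forall a b : A, a + b = 0 -> a = 0 /\ b = 0;
  entire : forall a b : A, a * b = 0 -> a = 0 \/ b = 0
}.

#[short(type="infoAlgType")]
HB.structure Definition InfoAlgebra :=
  {A of GRing.ComNzSemiRing A & isInfoAlgebra A}.

(* The order is a field of its own rather than an Order.POrder structure: HB
   rejects a join of POrder with semirings that is not below Num.POrderedZmodule,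
   whose objects have opposites. *)
HB.mixin Record isPosInfoAlgebra A of InfoAlgebra A := {
  pia_le : rel A;
  pia_le_refl : reflexive pia_le;
  pia_le_anti : antisymmetric pia_le;
  pia_le_trans : transitive pia_le;
  pia_leD2r : forall x y z : A, pia_le x y -> pia_le (x + z) (y + z);
  pia_leM2r : forall x y z : A, pia_le x y -> pia_le (x * z) (y * z);
  pia_le0x : forall x : A, pia_le 0 x
}.

#[short(type="posInfoAlgType")]
HB.structure Definition PosInfoAlgebra :=
  {A of InfoAlgebra A & isPosInfoAlgebra A}.

Definition is_ideal (S : comNzSemiRingType) (I : set S) : Prop :=
  [/\ I !=set0,
      forall a b, I a -> I b -> I (a + b)
    & forall s a, I a -> I (s * a)].

Definition proper_ideal (S : comNzSemiRingType) (I : set S) : Prop :=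
  is_ideal I /\ I <> setT.

Definition maximal_ideal (S : comNzSemiRingType) (I : set S) : Prop :=
  proper_ideal I /\ forall J : set S, proper_ideal J -> I `<=` J -> J = I.

Definition local_semiring (S : comNzSemiRingType) : Prop :=
  exists! M : set S, maximal_ideal M.

(* The carrier is the tagged union, so A and L are disjoint by construction. *)
Definition overflow (d : Order.disp_t)
    (A : posInfoAlgType) (L : joinSemilatticeType d) : Type := (A + L)%type.

Section Overflow.
Context (d : Order.disp_t) (A : posInfoAlgType) (L : joinSemilatticeType d).
Local Notation S := (overflow A L).

Definition ofA (a : A) : S := inl a.
Definition ofL (l : L) : S := inr l.

Definition overflow_le (x y : S) : bool :=
  match x, y with
  | inl a, inl b => pia_le a b
  | inl _, inr _ => true
  | inr _, inl _ => false
  | inr k, inr l => (k <= l)%O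
  end.

(* The sup of an element of A and an element l of L is l; see
   overflow_add_sup and overflow_mul_sup below. *)
Definition overflow_add (x y : S) : S :=
  match x, y with
  | inl a, inl b => ofA (a + b)
  | inl _, inr l => ofL l
  | inr l, inl _ => ofL l
  | inr k, inr l => ofL (k `|` l)%O
  end.

Definition overflow_mul (x y : S) : S :=
  match x, y with
  | inl a, inl b => ofA (a * b)
  | inl a, inr l => if a == 0 then ofA 0 else ofL l
  | inr l, inl a => if a == 0 then ofA 0 else ofL l
  | inr k, inr l => ofL (k `|` l)%O
  end.

HB.instance Definition _ := Choice.copy S (A + L)%type.

Fact overflow_le_refl : reflexive overflow_le.
Proof. by case=> x /=; [exact: pia_le_refl | exact: lexx]. Qed.

Fact overflow_le_anti : antisymmetric overflow_le.
Proof. by case=> x [] y //= => [/pia_le_anti | /le_anti] ->. Qed.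

Fact overflow_le_trans : transitive overflow_le.
Proof. by case=> y [] x [] z //=; [exact: pia_le_trans | exact: le_trans]. Qed.

Fact overflow_addA : associative overflow_add.
Proof. by case=> x [] y [] z //=; rewrite ?addrA ?joinA. Qed.

Fact overflow_addC : commutative overflow_add.
Proof. by case=> x [] y //=; rewrite 1?addrC 1?joinC. Qed.

Fact overflow_add0 : left_id (ofA 0) overflow_add.
Proof. by case=> x //=; rewrite add0r. Qed.

HB.instance Definition _ :=
  GRing.isNmodule.Build S overflow_addA overflow_addC overflow_add0.

Let mul_eq0 (a b : A) : (a * b == 0) = (a == 0) || (b == 0).
Proof.
apply/eqP/orP => [/entire[] -> |[] /eqP ->]; rewrite ?mul0r ?mulr0 ?eqxx; auto.
Qed.

Let add_eq0 (a b : A) : (a + b == 0) = (a == 0) && (b == 0).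
Proof.
apply/eqP/andP => [/zerosumfree[-> ->] |[/eqP -> /eqP ->]]; last exact: addr0.
by rewrite eqxx.
Qed.

Fact overflow_mulC : commutative overflow_mul.
Proof. by case=> x [] y //=; rewrite 1?mulrC 1?joinC. Qed.

Fact overflow_mulA : associative overflow_mul.
Proof.
case=> x [] y [] z /=; rewrite ?mulrA ?joinA //=;
  try (case: (eqVneq x 0) => [x0|/negPf x0] /=);
  try (case: (eqVneq y 0) => [y0|/negPf y0] /=);
  try (case: (eqVneq z 0) => [z0|/negPf z0] /=);
  by rewrite ?mul_eq0 ?x0 ?y0 ?z0 ?mul0r ?mulr0 ?eqxx.
Qed.

Fact overflow_mul1 : left_id (ofA 1) overflow_mul.
Proof. by case=> x /=; rewrite ?mul1r ?(negPf (oner_neq0 _)). Qed.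

Fact overflow_mulDl : left_distributive overflow_mul overflow_add.
Proof.
case=> x [] y [] z /=; rewrite ?mulrDl ?add_eq0 //=;
  try (case: (eqVneq x 0) => [x0|/negPf x0] /=);
  try (case: (eqVneq y 0) => [y0|/negPf y0] /=);
  try (case: (eqVneq z 0) => [z0|/negPf z0] /=);
  rewrite ?x0 ?y0 ?z0 ?mulr0 ?addr0 ?joinxx //.
- by rewrite joinCA joinxx joinC.
- by rewrite -joinA joinxx.
- by rewrite joinACA joinxx.
Qed.

Fact overflow_mul0 : left_zero (ofA 0) overflow_mul.
Proof. by case=> x /=; rewrite ?mul0r ?eqxx. Qed.

Fact overflow_1_neq0 : ofA 1 != ofA 0.
Proof. by apply/eqP => -[/eqP]; rewrite (negPf (oner_neq0 _)). Qed.

HB.instance Definition _ :=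
  GRing.Nmodule_isComNzSemiRing.Build S overflow_mulA overflow_mulC
    overflow_mul1 overflow_mulDl overflow_mul0 overflow_1_neq0.

Fact overflow_zerosumfree (x y : S) : x + y = 0 -> x = 0 /\ y = 0.
Proof.
case: x y => x [] y // [] /eqP.
by rewrite add_eq0 => /andP[/eqP -> /eqP ->].
Qed.

Fact overflow_entire (x y : S) : x * y = 0 -> x = 0 \/ y = 0.
Proof.
case: x y => x [] y //=; rewrite /GRing.mul /=.
- by case=> /entire[] ->; [left | right].
- by case: eqVneq => // -> _; left.
- by case: eqVneq => // -> _; right.
Qed.

HB.instance Definition _ :=
  isInfoAlgebra.Build S overflow_zerosumfree overflow_entire.

Fact overflow_leD2r (x y z : S) :
  overflow_le x y -> overflow_le (x + z) (y + z).
Proof.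
case: x y z => x [] y [] z //=; first exact: pia_leD2r.
- by move=> _; exact: leUr.
- by move=> xy; apply: leU2.
Qed.

Fact overflow_le0x (x : S) : overflow_le 0 x.
Proof. by case: x => x //=; exact: pia_le0x. Qed.

Fact overflow_leM2r (x y z : S) :
  overflow_le x y -> overflow_le (x * z) (y * z).
Proof.
case: x y z => x [] y [] z; rewrite /GRing.mul //=.
- exact: pia_leM2r.
- case: (eqVneq x 0) => [->|x0]; case: (eqVneq y 0) => [->|y0] //= xy.
    by case/eqP: x0; apply: pia_le_anti; rewrite xy pia_le0x.
- by case: (eqVneq z 0) => [->|_] //= _; rewrite mulr0 pia_le_refl.
- by case: (eqVneq x 0) => //= _ _; rewrite leUr.
- by case: (eqVneq z 0) => //= _ _; exact: pia_le_refl.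
- by move=> xy; apply: leU2.
Qed.

HB.instance Definition _ :=
  isPosInfoAlgebra.Build S overflow_le_refl overflow_le_anti overflow_le_trans
    overflow_leD2r overflow_leM2r overflow_le0x.

Definition is_sup2 (x y z : S) : Prop :=
  [/\ pia_le x z, pia_le y z
    & forall w, pia_le x w -> pia_le y w -> pia_le z w].

Let supAL (a : A) (l : L) : is_sup2 (ofA a) (ofL l) (ofL l).
Proof. by split=> //; exact: overflow_le_refl. Qed.

Let supLA (a : A) (l : L) : is_sup2 (ofL l) (ofA a) (ofL l).
Proof. by split=> //; exact: overflow_le_refl. Qed.

Let supLL (k l : L) : is_sup2 (ofL k) (ofL l) (ofL (k `|` l)%O).
Proof.
split; rewrite /pia_le /= ?leUl ?leUr //.
by case=> w //= kw lw; rewrite leUx kw.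
Qed.

Lemma overflow_add_sup (x y : S) :
  ~ (range ofA x /\ range ofA y) -> is_sup2 x y (x + y).
Proof.
case: x y => x [] y nA; [|exact: supAL|exact: supLA|exact: supLL].
by case: nA; split; [exists x | exists y].
Qed.

Lemma overflow_mul_sup (x y : S) :
  x <> 0 -> y <> 0 -> ~ (range ofA x /\ range ofA y) -> is_sup2 x y (x * y).
Proof.
case: x y => x [] y x0 y0 nA; last exact: supLL.
- by case: nA; split; [exists x | exists y].
- rewrite /GRing.mul /=; case: eqVneq => [xE|_]; last exact: supAL.
  by case: x0; rewrite xE.
- rewrite /GRing.mul /=; case: eqVneq => [yE|_]; last exact: supLA.
  by case: y0; rewrite yE.
Qed.

End Overflow.

Arguments ofA {d} A L a.
Arguments ofL {d} A L l.

(* Main.v *)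
(** A maximal ideal [M] of [S] is contained in [M `|` L], which is again a
    proper ideal, so it contains [L]. Hence [I |-> I `|` L] and [J |-> J `&` A]
    are inverse bijections between the maximal ideals of [A] and of [S]. *)
Require Import Defs.
From mathcomp Require Import all_boot all_order all_algebra.
From mathcomp Require Import boolp classical_sets.
From mathcomp Require wochoice.

Local Open Scope classical_set_scope.

Import GRing.Theory.

Section Ideals.
Context {S : comNzSemiRingType} {I : set S}.
Local Open Scope ring_scope.

Lemma is_ideal0 : is_ideal I -> I 0.
Proof. by case=> -[a Ia] _ IM; rewrite -(mul0r a); exact: IM. Qed.

(** An ideal containing [1] contains every [x = x * 1]. In this form properness passes easily
    between [A] and the overflow semiring, whose unit is [ofA A L 1]. *)
Lemma proper_idealP : Defs.proper_ideal I <-> is_ideal I /\ ~ I 1.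
Proof.
split=> -[idI]; last by move=> I1; split=> // IT; apply: I1; rewrite IT.
move=> IT; split=> // I1; apply: IT; rewrite -subTset => x _.
by case: idI => _ _ IM; rewrite -(mulr1 x); exact: IM.
Qed.

End Ideals.

Section OverflowIdeals.
Context {d : Order.disp_t} {A : posInfoAlgType} {L : joinSemilatticeType d}.
Implicit Types (I m : set A) (J M : set (overflow A L)).
Local Open Scope ring_scope.

Definition ideal_ext I : set (overflow A L) :=
  ofA A L @` I `|` range (ofL A L).

Definition ideal_restr J : set A := ofA A L @^-1` J.

Lemma ideal_extA I a : ideal_ext I (ofA A L a) <-> I a.
Proof.
by split=> [[[b Ib [<-]]|[]]|Ia] //; left; exists a.
Qed.

Lemma ideal_extL I l : ideal_ext I (ofL A L l).
Proof. by right; exists l. Qed.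

Lemma ideal_extK I : ideal_restr (ideal_ext I) = I.
Proof. by apply/seteqP; split=> a /ideal_extA. Qed.

(** No ideal property is needed: passing to [ideal_ext (ideal_restr J)] keeps the [A]-part of [J]
    and fills up the [L]-part. *)
Lemma sub_ideal_ext_restr J : J `<=` ideal_ext (ideal_restr J).
Proof. by case=> [a Ja|l _]; [apply/ideal_extA | exact: ideal_extL]. Qed.

Lemma ideal_extS I1 I2 : I1 `<=` I2 -> ideal_ext I1 `<=` ideal_ext I2.
Proof.
move=> I12 [a /ideal_extA /I12 I2a|l _]; last exact: ideal_extL.
exact/ideal_extA.
Qed.

(** A sum with a term in [L] lies in [L], and a product with a factor in [L] lies in [L] or is [0],
    so only sums and products inside [A] use closure of [I]. *)
Lemma is_ideal_ext I : is_ideal I -> is_ideal (ideal_ext I).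
Proof.
move=> idI; have I0 := is_ideal0 idI; case: idI => _ ID IM; split.
- by exists 0; apply/ideal_extA.
- move=> [a|k] [b|l]; try by move=> _ _; exact: ideal_extL.
  by move=> /ideal_extA Ia /ideal_extA Ib; apply/ideal_extA; exact: ID.
- move=> [a|k] [b|l]; rewrite /GRing.mul /=.
  + by move=> /ideal_extA Ib; apply/ideal_extA; exact: IM.
  (* The product of [0] with an element of [L] falls back into [A]; it stays in the set because [I]
     contains [0]. *)
  + by case: eqP => _ _; [apply/ideal_extA | exact: ideal_extL].
  + by case: eqP => _ _; [apply/ideal_extA | exact: ideal_extL].
  + by move=> _; exact: ideal_extL.
Qed.

(** This is a preimage under [ofA], which respects [0], [+] and [*] by computation. *)
Lemma is_ideal_restr J : is_ideal J -> is_ideal (ideal_restr J).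
Proof.
move=> idJ; have J0 := is_ideal0 idJ; case: idJ => _ JD JM; split.
- by exists 0.
- by move=> a b Ja Jb; exact: (JD _ _ Ja Jb).
- by move=> s a Ja; exact: (JM (ofA A L s) _ Ja).
Qed.

Lemma proper_ideal_ext I : Defs.proper_ideal I ->
  Defs.proper_ideal (ideal_ext I).
Proof.
move=> /proper_idealP[idI nI1]; apply/proper_idealP.
by split; [exact: is_ideal_ext | move=> /ideal_extA].
Qed.

Lemma proper_ideal_restr J : Defs.proper_ideal J ->
  Defs.proper_ideal (ideal_restr J).
Proof.
move=> /proper_idealP[idJ nJ1]; apply/proper_idealP.
by split; first exact: is_ideal_restr.
Qed.

Lemma maximal_ideal_restrK M :
  maximal_ideal M -> ideal_ext (ideal_restr M) = M.
Proof.
case=> prM maxM; apply: maxM; last exact: sub_ideal_ext_restr.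
exact/proper_ideal_ext/proper_ideal_restr.
Qed.

Lemma maximal_ideal_ext m : maximal_ideal m -> maximal_ideal (ideal_ext m).
Proof.
case=> prm maxm; split=> [|J prJ mJ]; first exact: proper_ideal_ext.
have Jm : ideal_restr J = m.
  apply: maxm; first exact: proper_ideal_restr.
  by rewrite -[X in X `<=` _]ideal_extK => a; exact: mJ.
(* Once the [A]-part of [J] is known to be [m], [J] can add nothing to [ideal_ext m]. *)
by apply/seteqP; split=> //; rewrite -Jm; exact: sub_ideal_ext_restr.
Qed.

Lemma maximal_ideal_restr M :
  maximal_ideal M -> maximal_ideal (ideal_restr M).
Proof.
move=> maxM; have MK := maximal_ideal_restrK _ maxM; case: maxM => prM maxM.
split=> [|I prI MI]; first exact: proper_ideal_restr.
(* It suffices that [ideal_ext I] equals [M], which is the maximality of [M] applied to a proper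
   ideal above it. *)
rewrite -[LHS]ideal_extK; congr ideal_restr.
apply: maxM; first exact: proper_ideal_ext.
by rewrite -[X in X `<=` _]MK; exact: ideal_extS.
Qed.

(** Uniqueness is carried across the bijection: each maximal ideal is rewritten as its round trip
    through the other semiring. *)
Lemma local_overflow : local_semiring A <-> local_semiring (overflow A L).
Proof.
split=> -[N [maxN uniqN]].
- exists (ideal_ext N); split=> [|M maxM]; first exact: maximal_ideal_ext.
  rewrite -[RHS](maximal_ideal_restrK _ maxM); congr ideal_ext.
  exact/uniqN/maximal_ideal_restr.
- exists (ideal_restr N); split=> [|m maxm]; first exact: maximal_ideal_restr.
  rewrite -[RHS]ideal_extK; congr ideal_restr.
  exact/uniqN/maximal_ideal_ext.
Qed.

End OverflowIdeals.

Theorem theorem4p7 (A : posInfoAlgType) (d : Order.disp_t) (L : orderType d)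
    (L_nonempty : [set: L] !=set0)
    (L_wo : wochoice.well_order (<=%O : rel L)) :
  [/\ forall m : set A, maximal_ideal m ->
        maximal_ideal (ofA A L @` m `|` range (ofL A L)),
      forall M : set (overflow A L), maximal_ideal M ->
        maximal_ideal (ofA A L @^-1` M)
    & local_semiring A <-> local_semiring (overflow A L)].
Proof.
split; first exact: maximal_ideal_ext.
- exact: maximal_ideal_restr.
- exact: local_overflow.
Qed.
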